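(* Let $Q_1,Q_2$ be sets of snapshots with disjoint domains such that, for each $i\in\{1,2\}$, $Q_i$ has no nonempty finalized subset and every actor of $\mathrm{dom}(Q_i)$ is potentially finalized in $Q_i$. Let $i\in\{1,2\}$ and let $B\in\mathrm{dom}(Q_i)$ be an actor that is not a receptionist in $Q_i$. Then $B$ is finalized in $Q_1\cup Q_2$ if and only if every receptionist in $Q_i$ on which $B$ depends in $Q_i$ is finalized in $Q_1\cup Q_2$.
   Context: A refob is a triple $(x,A,B)$ of a token $x$, owner actor $A$ and target actor $B$, written $x: A\to B$. A fact is one of $\mathrm{Created}(x)$, $\mathrm{Released}(x)$, $\mathrm{CreatedUsing}(x,y)$, $\mathrm{Activated}(x)$, $\mathrm{Unreleased}(x)$, $\mathrm{SentCount}(x,n)$, $\mathrm{RecvCount}(x,n)$ ($n\in\mathbb N$). A knowledge set $\Phi$ is a finite set of facts; $\Phi\vdash\varphi$ means $\varphi$ is derivable from $\Phi$ in first-order logic plus the rules: if no $\mathrm{SentCount}(x,n)\in\Phi$ then $\Phi\vdash\mathrm{SentCount}(x,0)$; if no $\mathrm{RecvCount}(x,n)\in\Phi$ then $\Phi\vdash\mathrm{RecvCount}(x,0)$; if $\Phi\vdash\mathrm{Created}(x)$ and $\Phi\not\vdash\mathrm{Released}(x)$ then $\Phi\vdash\mathrm{Unreleased}(x)$; if $\Phi\vdash\mathrm{CreatedUsing}(x,y)$ then $\Phi\vdash\mathrm{Created}(y)$. A set of snapshots $Q$ is a finite partial map from actors to knowledge sets; unions are unions of partial maps and subsets are restrictions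 to subsets of the domain. For a refob $x:A\to B$: $Q\vdash\mathrm{Activated}(x)$, $Q\vdash\mathrm{SentCount}(x,n)$, $Q\vdash\mathrm{CreatedUsing}(x,y)$ mean $A\in\mathrm{dom}(Q)$ and $Q(A)$ derives the fact; $Q\vdash\mathrm{Created}(x)$, $Q\vdash\mathrm{Released}(x)$, $Q\vdash\mathrm{RecvCount}(x,n)$ mean $B\in\mathrm{dom}(Q)$ and $Q(B)$ derives the fact. $Q\vdash\mathrm{Chain}(x:A\to B)$ iff there are refobs $x_1:A_1\to B,\dots,x_n:A_n\to B$ with $Q\vdash\mathrm{Created}(x_1)$, $Q\not\vdash\mathrm{Released}(x_1)$, for all $i<n$ $Q\vdash\mathrm{CreatedUsing}(x_i,x_{i+1})$ and $Q\not\vdash\mathrm{Released}(x_{i+1})$, and $A_n=A$, $x_n=x$. $Q\vdash\mathrm{Relevant}(x)$ iff for some $n$, $Q\vdash\mathrm{Activated}(x)$, $Q\vdash\mathrm{SentCount}(x,n)$ and $Q\vdash\mathrm{RecvCount}(x,n)$. $Q$ is finalized if for all $B\in\mathrm{dom}(Q)$ and all refobs $x:A\to B$, $Q\vdash\mathrm{Chain}(x)$ implies $A\in\mathrm{dom}(Q)$ and $Q\vdash\mathrm{Relevant}(x)$. $B$ depends on $A$ in $Q$ if $A=B$ or there is a sequence of refobs $x_1:A_1\to A_2,\dots,x_{n-1}:A_{n-1}\to A_n$ ($n\ge2$) with $A_1=A$, $A_n=B$ and $Q\vdash\mathrm{Chain}(x_i)$ for each $i<n$. An actor $C$ is finalized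 in $Q$ if for every $B$ on which $C$ depends in $Q$ and every refob $x:A\to B$, $Q\vdash\mathrm{Chain}(x)$ implies $Q\vdash\mathrm{Relevant}(x)$. $C$ is potentially finalized in $Q$ if for every $B$ on which $C$ depends in $Q$ and every refob $x:A\to B$, $Q\vdash\mathrm{Chain}(x)$ implies $Q\vdash\mathrm{Relevant}(x)$ or $A\notin\mathrm{dom}(Q)$. $B$ is a receptionist in $Q$ if $B\in\mathrm{dom}(Q)$ and there is a refob $x:A\to B$ with $Q\vdash\mathrm{Chain}(x)$ and $A\notin\mathrm{dom}(Q)$. *)

(* Defs.v *)
From HB Require Import structures.
From mathcomp Require Import all_boot finmap.

Set Implicit Arguments.
Unset Strict Implicit.
Unset Printing Implicit Defensive.

Local Open Scope fset_scope.
Local Open Scope fmap_scope.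

Record refob (Token Actor : Type) :=
  Refob { token : Token; owner : Actor; target : Actor }.

Section RefobChoice.
Variables Token Actor : choiceType.

Definition prod_of_refob (x : refob Token Actor) :=
  (token x, owner x, target x).
Definition refob_of_prod (p : Token * Actor * Actor) :=
  Refob p.1.1 p.1.2 p.2.

Lemma prod_of_refobK : cancel prod_of_refob refob_of_prod.
Proof. by case. Qed.

HB.instance Definition _ :=
  Choice.copy (refob Token Actor) (can_type prod_of_refobK).

End RefobChoice.

Inductive fact (Token Actor : Type) :=
  | Created of refob Token Actor
  | Released of refob Token Actor
  | CreatedUsing of refob Token Actor & refob Token Actor
  | Activated of refob Token Actor
  | Unreleased of refob Token Actor
  | SentCount of refob Token Actor & nat
  | RecvCount of refob Token Actor & nat.

Section FactChoice.
Variables Token Actor : choiceType.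
Local Notation refob := (refob Token Actor).
Local Notation fact := (fact Token Actor).

Definition code_of_fact (f : fact) : nat * seq refob * nat :=
  match f with
  | Created x => (0, [:: x], 0)
  | Released x => (1, [:: x], 0)
  | CreatedUsing x y => (2, [:: x; y], 0)
  | Activated x => (3, [:: x], 0)
  | Unreleased x => (4, [:: x], 0)
  | SentCount x n => (5, [:: x], n)
  | RecvCount x n => (6, [:: x], n)
  end.

Definition fact_of_code (c : nat * seq refob * nat) : option fact :=
  match c with
  | (0, [:: x], _) => Some (Created x)
  | (1, [:: x], _) => Some (Released x)
  | (2, [:: x; y], _) => Some (CreatedUsing x y)
  | (3, [:: x], _) => Some (Activated x)
  | (4, [:: x], _) => Some (Unreleased x)
  | (5, [:: x], n) => Some (SentCount x n)
  | (6, [:: x], n) => Some (RecvCount x n)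
  | _ => None
  end.

Lemma code_of_factK : pcancel code_of_fact fact_of_code.
Proof. by case. Qed.

HB.instance Definition _ := Choice.copy fact (pcan_type code_of_factK).

End FactChoice.

Definition knowledge (Token Actor : choiceType) := {fset fact Token Actor}.

Definition snapshots (Token Actor : choiceType) :=
  {fmap Actor -> knowledge Token Actor}.

Section Derivation.
Variables Token Actor : choiceType.
Local Notation refob := (refob Token Actor).
Local Notation fact := (fact Token Actor).
Local Notation knowledge := (knowledge Token Actor).
Implicit Types (Phi : knowledge) (x y : refob) (phi : fact).

(* Facts are atoms, so from a set of facts first-order logic alone derives    *)
(* exactly the facts of the set ([der_mem]).  The rule for [Unreleased] has   *)
(* the negative premise "Phi does not derive Released(x)"; here the judgement *)
(* occurring in that premise is the parameter [D].                            *)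
Inductive derives_rules (D : fact -> Prop) Phi : fact -> Prop :=
  | der_mem phi : phi \in Phi -> derives_rules D Phi phi
  | der_sent0 x : (forall n, SentCount x n \notin Phi) ->
      derives_rules D Phi (SentCount x 0)
  | der_recv0 x : (forall n, RecvCount x n \notin Phi) ->
      derives_rules D Phi (RecvCount x 0)
  | der_unreleased x :
      derives_rules D Phi (Created x) -> ~ D (Released x) ->
      derives_rules D Phi (Unreleased x)
  | der_created x y :
      derives_rules D Phi (CreatedUsing x y) -> derives_rules D Phi (Created y).

(* The system is stratified: the inner instance disables the [Unreleased]     *)
(* rule, which cannot affect the derivability of [Released].  By              *)
(* [derives_fixpoint], the negative premise is about [derives] itself.        *)
Definition derives Phi : fact -> Prop :=
  derives_rules (derives_rules (fun=> True) Phi) Phi.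

Lemma derives_rules_Released (D D' : fact -> Prop) Phi x :
  derives_rules D Phi (Released x) -> derives_rules D' Phi (Released x).
Proof.
move: {-2}(Released x) (erefl (Released x)) => phi E H.
by case: H E => // psi psiPhi E; apply: der_mem.
Qed.

Lemma derives_fixpoint Phi phi :
  derives Phi phi <-> derives_rules (derives Phi) Phi phi.
Proof.
split; elim=> {phi}; first [by move=> *; apply: der_mem
  | by move=> *; apply: der_sent0 | by move=> *; apply: der_recv0
  | by move=> x y _; apply: der_created | idtac];
  move=> x _ dC nR; apply: der_unreleased => // dR;
  by apply: nR; apply: derives_rules_Released dR.
Qed.

End Derivation.

Section Snapshots.
Variables Token Actor : choiceType.
Local Notation refob := (refob Token Actor).
Local Notation fact := (fact Token Actor).
Local Notation snapshots := (snapshots Token Actor).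
Implicit Types (Q : snapshots) (x : refob) (A B C : Actor) (phi : fact).

(* The actor whose knowledge set decides a fact.  Facts [Unreleased x] are    *)
(* never consulted at the level of sets of snapshots; they are placed with    *)
(* the facts [Created x] and [Released x] from which they are derived.        *)
Definition location phi : Actor :=
  match phi with
  | Activated x | SentCount x _ | CreatedUsing x _ => owner x
  | Created x | Released x | RecvCount x _ | Unreleased x => target x
  end.

Definition sderives Q phi : Prop :=
  exists2 Phi, Q.[? location phi] = Some Phi & derives Phi phi.

Definition Chain Q x : Prop :=
  exists (n : nat) (xs : nat -> refob),
    [/\ 1 <= n /\ (forall i, 1 <= i <= n -> target (xs i) = target x),
        sderives Q (Created (xs 1)),
        ~ sderives Q (Released (xs 1)),
        forall i, 1 <= i < n ->
          sderives Q (CreatedUsing (xs i) (xs i.+1)) /\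
          ~ sderives Q (Released (xs i.+1))
      & xs n = x].

Definition Relevant Q x : Prop :=
  exists n, [/\ sderives Q (Activated x), sderives Q (SentCount x n)
              & sderives Q (RecvCount x n)].

Definition finalized_set Q : Prop :=
  forall B, B \in domf Q -> forall x, target x = B ->
    Chain Q x -> owner x \in domf Q /\ Relevant Q x.

Definition has_nonempty_finalized_subset Q : Prop :=
  exists S : {fset Actor},
    [/\ S `<=` domf Q, S != fset0 & finalized_set Q.[& S]].

Definition depends_on Q B A : Prop :=
  A = B \/
  exists (n : nat) (As : nat -> Actor) (xs : nat -> refob),
    [/\ 2 <= n, As 1 = A, As n = B
      & forall i, 1 <= i < n ->
          [/\ owner (xs i) = As i, target (xs i) = As i.+1 & Chain Q (xs i)]].

Definition finalized Q C : Prop :=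
  forall B, depends_on Q C B -> forall x, target x = B ->
    Chain Q x -> Relevant Q x.

Definition potentially_finalized Q C : Prop :=
  forall B, depends_on Q C B -> forall x, target x = B ->
    Chain Q x -> Relevant Q x \/ owner x \notin domf Q.

Definition receptionist Q B : Prop :=
  B \in domf Q /\
  exists x, [/\ target x = B, Chain Q x & owner x \notin domf Q].

End Snapshots.

(* Main.v *)
(** Going back along a dependency path of [Q1 + Q2] that ends at a
    non-receptionist of [Qi], the path stays inside [Qi] until it meets a
    receptionist of [Qi]: a chain of the union towards an actor of [Qi] that
    leaves [Qi] makes this actor a receptionist, since the initial segment of
    the chain up to the first owner outside [Qi] is a chain of [Qi].  Before a
    receptionist is met, potential finalization in [Qi] is finalization. *)
Require Import Defs.
From mathcomp Require Import all_boot finmap.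
From Stdlib Require Import Classical_Prop.

Set Implicit Arguments.
Unset Strict Implicit.
Unset Printing Implicit Defensive.

Section ChainsAndDependencies.
Variables Token Actor : choiceType.
Local Notation refob := (refob Token Actor).
Local Notation snapshots := (snapshots Token Actor).
Implicit Types (Q : snapshots) (x y : refob) (A B C : Actor).

Lemma Chain_created Q x :
  sderives Q (Created x) -> ~ sderives Q (Released x) -> Chain Q x.
Proof.
by move=> cx nrx; exists 1, (fun=> x); split=> // i; case: i => [|[]].
Qed.

Lemma Chain_step Q x y :
  target y = target x -> sderives Q (CreatedUsing x y) ->
  ~ sderives Q (Released y) -> Chain Q x -> Chain Q y.
Proof.
move=> tyx cxy nry [n [xs [[n_gt0 tgt] c1 nr1 step xsn]]].
exists n.+1, (fun i => if i <= n then xs i else y); rewrite n_gt0 ltnn.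
split=> // [|i /andP[i_gt0]].
  split=> // i /andP[i_gt0 _]; case: leqP => // le_in.
  by rewrite tgt ?i_gt0 // tyx.
rewrite ltnS => le_in; case: (ltngtP i n) le_in => [lt_in||->] // _; last first.
  by rewrite xsn.
by apply: step; rewrite i_gt0.
Qed.

(** Induction along a chain: with [Chain_created] and [Chain_step] it presents chains as an
    inductive predicate, so that later arguments avoid indexed sequences. *)
Lemma Chain_elim Q (P : refob -> Prop) :
  (forall x, sderives Q (Created x) -> ~ sderives Q (Released x) -> P x) ->
  (forall x y, target y = target x -> sderives Q (CreatedUsing x y) ->
    ~ sderives Q (Released y) -> P x -> P y) ->
  forall x, Chain Q x -> P x.
Proof.
move=> P1 PS x [n [xs [[n_gt0 tgt] c1 nr1 step <-]]].
suff P_xs i : 0 < i <= n -> P (xs i) by apply: P_xs; rewrite n_gt0 leqnn.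
elim: i => // -[_ _|i IHi /andP[_ lt_in]]; first exact: P1.
have [cu nr] := step i.+1 lt_in.
apply: PS cu nr (IHi (ltnW lt_in)).
by rewrite !tgt ?lt_in //= ltnW.
Qed.

(** A path is listed from its far end towards [B], so the new edge [x] is put in front and the old
    indices shift by one. *)
Lemma depends_on_step Q B x :
  Chain Q x -> depends_on Q B (target x) -> depends_on Q B (owner x).
Proof.
move=> cx [tx|[n [As [xs [n_gt1 As1 Asn step]]]]]; right.
  exists 2, (fun i => if i == 1 then owner x else B), (fun=> x); split=> //.
  by case=> [|[|i]].
exists n.+1, (fun i => if i == 1 then owner x else As i.-1),
  (fun i => if i == 1 then x else xs i.-1); split=> //.
- exact: ltnW.
- by case: n n_gt1 Asn {step} => [|[]].
- case=> [//|[|i] lt_in] /=; first by split.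
  exact: step.
Qed.

Lemma depends_on_elim Q B (P : Actor -> Prop) :
  P B -> (forall x, Chain Q x -> P (target x) -> P (owner x)) ->
  forall A, depends_on Q B A -> P A.
Proof.
move=> PB PS A [-> //|[n [As [xs [n_gt1 <- Asn step]]]]].
(* Induction backwards from [As n = B]; the value [k = n - 1] reaches [As 1]. *)
suff P_As k : k < n -> P (As (n - k)).
  by rewrite -(subKn (ltnW n_gt1)); apply: P_As; rewrite subn1 ltn_predL ltnW.
elim: k => [_|k IHk lt_kn]; first by rewrite subn0 Asn.
have [|ox tx cx] := step (n - k.+1).
  by rewrite subn_gt0 lt_kn ltn_subrL (ltnW n_gt1).
by rewrite -ox; apply: PS; rewrite ?tx ?subnSK 1?ltnW //; apply/IHk/ltnW.
Qed.

Lemma depends_on_trans Q C B A :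
  depends_on Q C B -> depends_on Q B A -> depends_on Q C A.
Proof.
move=> dCB; move: A; apply: depends_on_elim => // x.
exact: depends_on_step.
Qed.

Lemma finalized_depends Q C B :
  finalized Q C -> depends_on Q C B -> finalized Q B.
Proof. by move=> finC dCB A dBA; apply/finC/(depends_on_trans dCB). Qed.

Lemma sderives_location Q phi : sderives Q phi -> location phi \in domf Q.
Proof. by case=> Phi; case: fndP. Qed.

Lemma owner_dom_nonreceptionist Q x :
  target x \in domf Q -> ~ receptionist Q (target x) ->
  Chain Q x -> owner x \in domf Q.
Proof.
move=> tx nrec cx; apply: contraPT nrec => ox.
by apply; split=> //; exists x.
Qed.

Section Extension.
Variables Q Q' : snapshots.
Hypothesis QQ' : {in domf Q, forall A, Q'.[? A]%fmap = Q.[? A]%fmap}.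

(** A fact is decided by the single snapshot at its location, where [Q] and [Q'] agree. *)
Lemma sderives_restrict phi :
  location phi \in domf Q -> sderives Q' phi -> sderives Q phi.
Proof. by move=> /QQ' eqQ [Phi]; rewrite eqQ; exists Phi. Qed.

Lemma sderives_extend phi : sderives Q phi -> sderives Q' phi.
Proof.
move=> dphi; case: (dphi) => Phi.
by rewrite -QQ' ?sderives_location //; exists Phi.
Qed.

Lemma Relevant_extend x : Relevant Q x -> Relevant Q' x.
Proof. by case=> n [? ? ?]; exists n; split; apply: sderives_extend. Qed.

(** The negative premises are the delicate point: [Q'] could derive a [Released] fact that [Q] does
    not. Such a fact is located at the target, and there the two agree once the target is in
    [domf Q]. *)
Lemma Chain_extend x : Chain Q x -> Chain Q' x.
Proof.
(* Membership of the target is carried through the induction: the initial [Created] fact provides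
   it, and the target is constant along a chain. *)
suff H : Chain Q x -> target x \in domf Q /\ Chain Q' x by case/H.
move: x; apply: Chain_elim => [x cx nrx|x y tyx cxy nry [tx cx]].
  have tx : target x \in domf Q := sderives_location cx.
  split=> //; apply: Chain_created (sderives_extend cx) _.
  by move=> /(@sderives_restrict (Released x) tx).
have ty : target y \in domf Q by rewrite tyx.
split=> //; apply: Chain_step tyx (sderives_extend cxy) _ cx.
by move=> /(@sderives_restrict (Released y) ty).
Qed.

(** The fact [CreatedUsing x y] is located at the owner of [x]. By induction [x] already has a chain
    in [Q], so this owner lies in [domf Q], the target not being a receptionist. *)
Lemma Chain_restrict x :
  target x \in domf Q -> ~ receptionist Q (target x) ->
  Chain Q' x -> Chain Q x.
Proof.
move=> tx nrec cx; move: x cx tx nrec.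
apply: Chain_elim => [x cx nrx tx _|x y tyx cxy nry IHx].
  apply: Chain_created; first exact: sderives_restrict cx.
  by move=> /sderives_extend.
rewrite tyx => tx nrec; have cx := IHx tx nrec.
have ox := owner_dom_nonreceptionist tx nrec cx.
apply: Chain_step tyx _ _ cx; last by move=> /sderives_extend.
exact: (@sderives_restrict (CreatedUsing x y) ox).
Qed.

Lemma depends_on_extend B A : depends_on Q B A -> depends_on Q' B A.
Proof.
move: A; apply: depends_on_elim => [|x /Chain_extend cx]; first by left.
exact: depends_on_step.
Qed.

(** Stated for any extension [Q'] of [Q], this treats both values of [i] at once. *)
Lemma finalized_extend_receptionists B :
  potentially_finalized Q B -> B \in domf Q -> ~ receptionist Q B ->
  finalized Q' B <->
  (forall R, receptionist Q R -> depends_on Q B R -> finalized Q' R).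
Proof.
move=> potB B_dom B_nrec; split=> [finB R _ dBR|finR].
  exact/(finalized_depends finB)/depends_on_extend.
(* Invariant along a path traced back from [B]: it is still at a non-receptionist of [Q], or it has
   met a finalized actor, and finalization passes to all actors further back. *)
have split_path C : depends_on Q' B C ->
    [/\ C \in domf Q, ~ receptionist Q C & depends_on Q B C] \/
    finalized Q' C.
  move: C; apply: depends_on_elim => [|x cx].
    by left; split=> //; left.
  case=> [[tx nrec dB]|fin_tx]; last first.
    right; apply: finalized_depends fin_tx _.
    by apply: depends_on_step cx _; left.
  have cQx := Chain_restrict tx nrec cx.
  have dBo := depends_on_step cQx dB.
  have [rec|nreco] := classic (receptionist Q (owner x)).
    by right; apply: finR.
  by left; split=> //; apply: owner_dom_nonreceptionist.
move=> C /split_path[[C_dom C_nrec dBC]|finC] x txC cx; last first.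
  by apply: (finC C) => //; left.
have cQx : Chain Q x by apply: Chain_restrict cx; rewrite txC.
have ox : owner x \in domf Q.
  by apply: owner_dom_nonreceptionist cQx; rewrite txC.
case: (potB C dBC x txC cQx) => [|/negP //].
exact: Relevant_extend.
Qed.

End Extension.

End ChainsAndDependencies.

Theorem theorem8p6 (Token Actor : choiceType) (Q1 Q2 : snapshots Token Actor)
    (disjQ : fdisjoint (domf Q1) (domf Q2))
    (nofin1 : ~ has_nonempty_finalized_subset Q1)
    (nofin2 : ~ has_nonempty_finalized_subset Q2)
    (potfin1 : forall C : Actor, C \in domf Q1 -> potentially_finalized Q1 C)
    (potfin2 : forall C : Actor, C \in domf Q2 -> potentially_finalized Q2 C)
    (Qi : snapshots Token Actor) (Qi_def : Qi = Q1 \/ Qi = Q2)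
    (B : Actor) (B_dom : B \in domf Qi) (B_nrec : ~ receptionist Qi B) :
  finalized (Q1 + Q2)%fset B <->
  (forall R : Actor, receptionist Qi R -> depends_on Qi B R ->
     finalized (Q1 + Q2)%fset R).
Proof.
apply: finalized_extend_receptionists => //; last first.
  by case: Qi_def B_dom => ->; [apply: potfin1|apply: potfin2].
(* The union favours its right operand, so agreement with [Q2] is immediate, while agreement with
   [Q1] uses disjointness. *)
case: Qi_def => -> A A_dom; rewrite fnd_cat; last by rewrite A_dom.
by rewrite (negPf (fdisjointP disjQ A A_dom)).
Qed.
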